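(* Let $N=2^n$ and let $\mathcal{A}=P(U_\omega)$ be an $N\times N$ diagonal matrix, where $P\in\mathbb{C}[x]$ has $\deg P=d$ and $|P(x)|^2\le c$ for all $x\in\mathbb{T}$. Then $\mathcal{A}/\sqrt{c}$ can be implemented (as the top-left block, with respect to one ancilla qubit, of a unitary circuit) using $\mathcal{O}(d\log N)$ 1- and 2-qubit gates.
   Context: $\mathbb{T}=\{x\in\mathbb{C}:|x|=1\}$, $\omega_N=e^{2\pi i/N}$, and $U_\omega=\sum_{j=0}^{N-1}\omega_N^j|j\rangle\langle j|$ where $|j\rangle$ is the computational basis state given by the binary representation of $j$ on $n=\log N$ qubits. Gates are arbitrary 1- and 2-qubit unitaries. *)

(* Defs.v *)
(* Complex numbers: mathcomp-real-closed's  R[i]  over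
   Stdlib's concrete reals  R  (a realType, hence rcfType, via Rstruct). *)
From HB Require Import structures.
From mathcomp Require Import all_boot all_order all_algebra.
From mathcomp Require Import complex.
From mathcomp Require Import Rstruct.
From Stdlib Require Reals.
Set Implicit Arguments. Unset Strict Implicit. Unset Printing Implicit Defensive.
Import Order.TTheory GRing.Theory Num.Theory.
Local Open Scope ring_scope.

(* the complex numbers *)
Notation C := (Rdefinitions.R[i]).

(* omega_N = e^{2 pi i / N} = cos(2 pi/N) + i sin(2 pi/N) *)
Definition omega (N : nat) : C :=
  Complex (Rtrigo_def.cos (2 * Rtrigo1.PI / N%:R)) (Rtrigo_def.sin (2 * Rtrigo1.PI / N%:R)).

(* U_omega = sum_j omega_N^j |j><j|, as an N x N matrix, N = 2^n
   (the dimension is written (2^n).-1.+1 so that polynomial evaluation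
   horner_mx, which needs a nontrivial square matrix ring, applies). *)
Definition Uomega (n : nat) : 'M[C]_((2 ^ n).-1.+1) :=
  \matrix_(i, j) (if i == j then omega (2 ^ n) ^+ i else 0).

(* A = P(U_omega) *)
Definition PofU (n : nat) (P : {poly C}) : 'M[C]_((2 ^ n).-1.+1) :=
  horner_mx (Uomega n) P.

(* unitary matrices *)
Definition unitary (k : nat) (U : 'M[C]_k) : Prop :=
  U *m (map_mx (fun z : C => z^*) U)^T = 1%:M.

(* the k-th qubit (bit k of the binary representation) of basis state x *)
Definition bit (k x : nat) : bool := odd (x %/ 2 ^ k).

(* 1- and 2-qubit gates on an m-qubit register *)
Inductive gate (m : nat) : Type :=
  | Gate1 (q : 'I_m) (U : 'M[C]_2)
  | Gate2 (a b : 'I_m) (U : 'M[C]_4).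

Definition gate_ok (m : nat) (g : gate m) : Prop :=
  match g with
  | Gate1 _ U => unitary U
  | Gate2 a b U => a <> b /\ unitary U
  end.

(* the 2^m x 2^m matrix of a gate: U acts on the chosen qubit(s),
   identity on all other qubits *)
Definition gate_mx (m : nat) (g : gate m) : 'M[C]_(2 ^ m) :=
  match g with
  | Gate1 q U =>
      \matrix_(x, y)
        if [forall k : 'I_m, (k != q) ==> (bit k x == bit k y)]
        then U (inord (bit q x)) (inord (bit q y)) else 0
  | Gate2 a b U =>
      \matrix_(x, y)
        if [forall k : 'I_m, ((k != a) && (k != b)) ==> (bit k x == bit k y)]
        then U (inord (2 * bit a x + bit b x)) (inord (2 * bit a y + bit b y))
        else 0
  end.

(* the unitary of a circuit [g1; ...; gk] (g1 applied first) *)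
Definition circuit_mx (m : nat) (s : seq (gate m)) : 'M[C]_(2 ^ m) :=
  foldl (fun W g => gate_mx g *m W) 1%:M s.

(* Main.v *)
(** After scaling, [|P| <= 1] on the unit circle. The trigonometric polynomial
    [1 - |P|^2] is nonnegative there, so by the Fejer-Riesz theorem it equals
    [|Q|^2] for a polynomial [Q] of degree at most [d]. In [|P|^2 + |Q|^2 = 1]
    the coefficient of [z^d] shows that the vectors of constant and of leading
    coefficients of [(P, Q)] are orthogonal, hence some unitary 2x2 matrix maps
    [(P, Q)] to [(z P', Q')] with [P'] and [Q'] of smaller degree. Iterating,
    [(P, Q)] is obtained from [(1, 0)] by [d + 1] rotations of the ancilla
    interleaved with [d] multiplications of its [|0>] component by [z]. At
    [z = omega^j] such a multiplication is [U_omega] controlled by the ancilla,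
    a product of [n] two-qubit phase gates, one for each bit of [j]. *)
Require Import Defs.
From HB Require Import structures.
From mathcomp Require Import all_boot all_order all_algebra.
From mathcomp Require Import complex.
From mathcomp Require Import Rstruct.
From mathcomp Require Import ring zify.
From Stdlib Require Reals.
Import Order.TTheory GRing.Theory Num.Theory.
Set Implicit Arguments. Unset Strict Implicit. Unset Printing Implicit Defensive.
Local Open Scope ring_scope.

(** * Nonnegative trigonometric polynomials *)

Section UnitCircle.

Variable K : numClosedFieldType.
Implicit Types (z a t : K) (p F P Q : {poly K}) (d : nat).

Lemma unitC_mulJ z : `|z| = 1 -> z * z^* = 1.
Proof. by move=> z1; rewrite -normCK z1 expr1n. Qed.

Lemma unitC_mulXJ d z : `|z| = 1 -> z ^+ d * z^* ^+ d = 1.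
Proof. by move=> z1; rewrite -exprMn unitC_mulJ // expr1n. Qed.

Lemma unitC_neq0 z : `|z| = 1 -> z != 0.
Proof. by move=> z1; rewrite -normr_gt0 z1 ltr01. Qed.

(** * Cayley parametrisation of the circle *)

(** The Cayley transform sends real numbers injectively into the circle. It supplies infinitely many
    points of the circle, and points as close to 1 as desired, by algebra alone. *)
Definition cayley t : K := (1 + 'i * t) / (1 - 'i * t).

Lemma cayley_den_mul t : (1 + 'i * t) * (1 - 'i * t) = 1 + t ^+ 2.
Proof. by rewrite mulrC -subr_sqr expr1n exprMn sqrCi mulN1r opprK. Qed.

Lemma cayley_den_neq0 t : t \is Num.real -> 1 - 'i * t != 0.
Proof.
move=> tR; apply/eqP => e; have := cayley_den_mul t; rewrite e mulr0.
by apply/eqP; rewrite eq_sym gt_eqF // ltr_wpDr // -realEsqr.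
Qed.

Lemma norm_cayley t : t \is Num.real -> `|cayley t| = 1.
Proof.
move=> tR; rewrite normf_div -[X in X / _]norm_conjC rmorphD rmorphM /=.
rewrite rmorph1 conjCi (conj_Creal tR) mulNr divff //.
by rewrite normr_eq0 cayley_den_neq0.
Qed.

Lemma cayley_sub1 t :
  t \is Num.real -> cayley t - 1 = 'i * t *+ 2 / (1 - 'i * t).
Proof. by move=> /cayley_den_neq0 h; rewrite /cayley; field. Qed.

Lemma cayley_sub1_neq0 t : t \is Num.real -> t != 0 -> cayley t - 1 != 0.
Proof.
move=> tR t0; rewrite cayley_sub1 // mulf_neq0 ?invr_eq0 ?cayley_den_neq0 //.
by rewrite -mulr_natr !mulf_neq0 ?neq0Ci ?pnatr_eq0.
Qed.

Lemma norm_cayley_sub1_le t : t \is Num.real -> `|cayley t - 1| <= `|t| *+ 2.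
Proof.
move=> tR; rewrite cayley_sub1 // normf_div normrMn normrM normCi mul1r.
rewrite ler_pdivrMr ?normr_gt0 ?cayley_den_neq0 // ler_peMr ?mulrn_wge0 //.
rewrite -(@ler_pXn2r _ 2) ?nnegrE // expr1n normCK rmorphB rmorphM /= rmorph1.
rewrite conjCi (conj_Creal tR) mulNr opprK mulrC cayley_den_mul.
by rewrite lerDl -realEsqr.
Qed.

Lemma cayley_inj : {in Num.real &, injective cayley}.
Proof.
move=> s t sR tR e.
have hs := cayley_den_neq0 sR; have ht := cayley_den_neq0 tR.
move/eqP: e; rewrite /cayley eqr_div // => /eqP e.
have /eqP : 2 * 'i * (s - t) = 0.
  by rewrite -[RHS](subrr ((1 + 'i * t) * (1 - 'i * s))) -{1}e; ring.
by rewrite !mulf_eq0 pnatr_eq0 (negbTE (neq0Ci _)) subr_eq0 => /eqP.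
Qed.

(** The images of 0, 1, 2, ... under [cayley] are distinct roots, and [size p] of them are too many
    for a nonzero [p]. *)
Lemma poly_unit_circle_eq0 p : (forall z, `|z| = 1 -> p.[z] = 0) -> p = 0.
Proof.
move=> p0; apply/eqP; apply: contraT => /max_poly_roots.
move=> /(_ [seq cayley k%:R | k <- iota 0 (size p)]).
rewrite size_map size_iota ltnn; apply.
  apply/allP => _ /mapP[k _ ->]; apply/rootP/p0/norm_cayley.
  exact: realn.
rewrite map_inj_uniq ?iota_uniq // => k l /cayley_inj.
by rewrite !realn => /(_ isT isT) /eqP; rewrite eqr_nat => /eqP.
Qed.

Lemma poly_unit_circle_inj p q :
  (forall z, `|z| = 1 -> p.[z] = q.[z]) -> p = q.
Proof.
move=> pq; apply/eqP; rewrite -subr_eq0; apply/eqP.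
by apply: poly_unit_circle_eq0 => z z1; rewrite hornerD hornerN pq ?subrr.
Qed.

(** * Conjugate reversal of polynomials *)

(* As a function on nonzero [z]: [z^d conj (p (1 / conj z))], for [p] of degree at
   most [d]. *)
Definition revJ d p : {poly K} := \poly_(i < d.+1) (p`_(d - i))^*.

Lemma horner_revJ d p z : (size p <= d.+1)%N -> z != 0 ->
  (revJ d p).[z] = z ^+ d * (p.[(z^*)^-1])^*.
Proof.
move=> sp z0; rewrite horner_poly (horner_coef_wide _ sp) rmorph_sum mulr_sumr.
rewrite (reindex_inj rev_ord_inj) /=; apply: eq_bigr => i _.
have le_id : (i <= d)%N by rewrite -ltnS.
rewrite subSS subKn // rmorphM rmorphXn /= fmorphV /= conjCK.
by rewrite mulrCA expfB_cond ?(negbTE z0) ?exprVn.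
Qed.

Lemma horner_revJ_unit d p z : (size p <= d.+1)%N -> `|z| = 1 ->
  (revJ d p).[z] = z ^+ d * (p.[z])^*.
Proof.
move=> sp z1; rewrite horner_revJ ?unitC_neq0 //.
have -> // : (z^*)^-1 = z.
by rewrite -[LHS]mul1r -(unitC_mulJ z1) mulfK // conjC_eq0 unitC_neq0.
Qed.

(** * Limit arguments at a point of the circle *)

Lemma norm_horner_unit_le p z : `|z| = 1 -> `|p.[z]| <= \sum_(i < size p) `|p`_i|.
Proof.
move=> z1; rewrite horner_coef; apply: le_trans (ler_norm_sum _ _ _) _.
by apply: ler_sum => i _; rewrite normrM normrX z1 expr1n mulr1.
Qed.

(** Up to a factor of modulus 1, the difference is the value at [z] of a polynomial vanishing at
    [a]; its cofactor by ['X - a] is bounded on the circle. *)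
Lemma horner_phase_lipschitz d p a : `|a| = 1 ->
  exists2 M : K, 0 <= M & forall z, `|z| = 1 ->
    `|p.[z] * z^* ^+ d - p.[a] * a^* ^+ d| <= M * `|z - a|.
Proof.
move=> a1; pose q := a ^+ d *: p - p.[a] *: 'X^d.
have [k qE] : exists k, q = k * ('X - a%:P).
  apply/factor_theorem/rootP.
  by rewrite /q hornerD hornerN !hornerZ hornerXn mulrC subrr.
exists (\sum_(i < size k) `|k`_i|); first exact: sumr_ge0.
move=> z z1; have [z0 a0] := (unitC_neq0 z1, unitC_neq0 a1).
have -> : p.[z] * z^* ^+ d - p.[a] * a^* ^+ d = (z^* * a^*) ^+ d * q.[z].
  rewrite /q hornerD hornerN !hornerZ hornerXn mulrBr exprMn.
  congr (_ - _).
    by rewrite -[LHS]mulr1 -(unitC_mulXJ d a1); ring.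
  by rewrite -[LHS]mulr1 -(unitC_mulXJ d z1); ring.
rewrite normrM normrX normrM !norm_conjC z1 a1 mulr1 expr1n mul1r.
rewrite qE hornerM hornerXsubC normrM ler_wpM2r //; exact: norm_horner_unit_le.
Qed.

Lemma near_unit_eq0 a (x L : K) : `|a| = 1 -> 0 <= L -> 0 <= x ->
  (forall z, `|z| = 1 -> z != a -> x <= L * `|z - a|) -> x = 0.
Proof.
move=> a1 L0 x0 xL; apply: contraTeq isT => xn0.
have x_gt0 : 0 < x by rewrite lt0r xn0.
(* The point [a * cayley t] is within [2 t] of [a], so the hypothesis would give [x <= 2 x / 3].
   Dividing by [L + x] instead of [L] covers [L = 0]. *)
pose t := x / ((L + x) *+ 3).
have Lx0 : 0 < L + x by rewrite ltr_wpDl.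
have t0 : 0 < t by rewrite divr_gt0 ?pmulrn_lgt0.
have tR : t \is Num.real by rewrite gtr0_real.
have zaE : a * cayley t - a = a * (cayley t - 1) by ring.
have := xL (a * cayley t).
have za0 : a * (cayley t - 1) != 0.
  exact: mulf_neq0 (unitC_neq0 a1) (cayley_sub1_neq0 tR (lt0r_neq0 t0)).
rewrite normrM a1 norm_cayley // mul1r -subr_eq0 zaE za0.
move=> /(_ erefl isT); rewrite normrM a1 mul1r => h.
have := le_trans h (ler_wpM2l L0 (norm_cayley_sub1_le tR)).
rewrite (gtr0_norm t0) => {}h.
have : x <= (L + x) * (t *+ 2).
  by apply: le_trans h _; rewrite ler_wpM2r ?mulrn_wge0 ?(ltW t0) // lerDl.
have -> : (L + x) * (t *+ 2) = x * (2 / 3).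
  by have := lt0r_neq0 Lx0; rewrite /t => Ln0; field.
by rewrite ler_pMr // ler_pdivlMr ?ltr0n // mul1r ler_nat.
Qed.

(* Compare the values at [a u] and [a u^*]: the linear terms nearly cancel. *)
Lemma nonneg_circle_double_root d p a : `|a| = 1 ->
  (forall z, `|z| = 1 -> 0 <= (z - a) * p.[z] * z^* ^+ d) -> p.[a] = 0.
Proof.
move=> a1 p_ge0; have [M M0 pM] := horner_phase_lipschitz d p a1.
pose w := a * (p.[a] * a^* ^+ d).
(* First-order expansion at [z = a u]: the nonnegative value is [(u - 1) w] up to a quadratic
   error. *)
have wE u : `|u| = 1 -> exists2 A, 0 <= A & `|A - (u - 1) * w| <= M * `|u - 1| ^+ 2.
  move=> u1; have au1 : `|a * u| = 1 by rewrite normrM a1 u1 mulr1.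
  exists ((a * u - a) * p.[a * u] * (a * u)^* ^+ d); first exact: p_ge0.
  have -> : (a * u - a) * p.[a * u] * (a * u)^* ^+ d - (u - 1) * w =
     a * (u - 1) * (p.[a * u] * (a * u)^* ^+ d - p.[a] * a^* ^+ d).
    by rewrite /w; ring.
  rewrite !normrM a1 mul1r expr2 mulrCA ler_wpM2l //.
  by apply: le_trans (pM _ au1) _; rewrite -[X in _ - X]mulr1 -mulrBr normrM a1 mul1r.
have w_le u : `|u| = 1 -> u - 1 != 0 -> `|w| <= (`|w| + M *+ 3) * `|u - 1|.
  move=> u1 un1; have uJ1 : `|u^*| = 1 by rewrite norm_conjC.
  have [A A0 AE] := wE _ u1; have [B B0 BE] := wE _ uJ1.
  have nJ : `|u^* - 1| = `|u - 1| by rewrite -norm_conjC rmorphB rmorph1 /= conjCK.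
  have sumJ : (u - 1) + (u^* - 1) = - `|u - 1| ^+ 2.
    rewrite normCK rmorphB rmorph1 /= mulrBl mulrBr mulr1 unitC_mulJ // mul1r.
    by ring.
  rewrite nJ in BE.
  (* By [sumJ] the linear terms add up to a quadratic one, so [A + B] is quadratic in [|u - 1|]. As
     [B >= 0], so is [A], and hence [w] is at most linear in [|u - 1|]. *)
  have AB : A + B <= (`|w| + M *+ 2) * `|u - 1| ^+ 2.
    rewrite -[A + B]ger0_norm ?addr_ge0 //.
    have -> : A + B = - `|u - 1| ^+ 2 * w + (A - (u - 1) * w) + (B - (u^* - 1) * w).
      by rewrite -sumJ; ring.
    apply: le_trans (ler_normD _ _) _.
    have -> : (`|w| + M *+ 2) * `|u - 1| ^+ 2 =
       (`|w| * `|u - 1| ^+ 2 + M * `|u - 1| ^+ 2) + M * `|u - 1| ^+ 2 by ring.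
    rewrite lerD //; apply: le_trans (ler_normD _ _) _; rewrite lerD //.
    by rewrite normrM normrN normrX normr_id mulrC.
  rewrite -(@ler_pM2r _ `|u - 1|) ?normr_gt0 // -mulrA -expr2 -normrM.
  rewrite [w * _]mulrC -[X in `|X|]opprK normrN.
  have -> : - ((u - 1) * w) = (A - (u - 1) * w) - A by ring.
  apply: le_trans (ler_normB _ _) _; rewrite (ger0_norm A0).
  have -> : (`|w| + M *+ 3) * `|u - 1| ^+ 2 =
    M * `|u - 1| ^+ 2 + (`|w| + M *+ 2) * `|u - 1| ^+ 2 by ring.
  by rewrite lerD //; apply: le_trans AB; rewrite lerDl.
have /eqP : `|w| = 0.
  apply: (@near_unit_eq0 1 _ (`|w| + M *+ 3)); rewrite ?normr1 ?addr_ge0 ?mulrn_wge0 //.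
  by move=> u u1 un1; apply: w_le; rewrite ?subr_eq0.
rewrite normr_eq0 !mulf_eq0 expf_eq0 conjC_eq0 (negbTE (unitC_neq0 a1)).
by rewrite andbF orbF /= => /eqP.
Qed.

(** Nonnegativity passes to the limit: at nearby points the value equals its modulus, and both vary
    in a Lipschitz way. *)
Lemma nonneg_circle_closed d p a : `|a| = 1 ->
  (forall z, `|z| = 1 -> z != a -> 0 <= p.[z] * z^* ^+ d) ->
  0 <= p.[a] * a^* ^+ d.
Proof.
move=> a1 p_ge0; have [M M0 pM] := horner_phase_lipschitz d p a1.
set v := p.[a] * a^* ^+ d.
suff /eqP : `|v - `|v| | = 0 by rewrite normr_eq0 subr_eq0 => /eqP ->.
apply: (@near_unit_eq0 a _ (M *+ 2)); rewrite ?mulrn_wge0 // => z z1 za.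
have := pM z z1; rewrite -/v => vM.
have {1}-> : v - `|v| = - (p.[z] * z^* ^+ d - v)
    + (`|p.[z] * z^* ^+ d| - `|v|).
  by rewrite (ger0_norm (p_ge0 _ z1 za)); ring.
apply: le_trans (ler_normD _ _) _; rewrite mulrnAl mulr2n normrN lerD //.
by apply: le_trans vM; apply: ler_dist_dist.
Qed.

(** * Fejer-Riesz factorisation *)

Lemma size_leq_coef0 p n : (size p <= n.+1)%N -> p`_n = 0 -> (size p <= n)%N.
Proof.
move=> sp pn; apply/leq_sizeP => i; rewrite leq_eqVlt => /predU1P[<- //|].
by move/leq_sizeP: sp; apply.
Qed.

Lemma coef0_divX p n : (size p <= n.+1)%N -> p`_0 = 0 ->
  exists2 q : {poly K}, p = q * 'X & (size q <= n)%N.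
Proof.
move=> sp p0; exists (drop_poly 1 p); last by rewrite size_drop_poly leq_subLR.
rewrite -{1}(poly_take_drop 1 p) expr1 -[RHS]add0r; congr (_ + _).
apply/polyP => i; rewrite coef_take_poly coef0.
by case: i => [|i]; rewrite ?p0.
Qed.

(** A real value equals its conjugate, and for [F.[z] * z^* ^+ d] on the circle this is exactly
    self-reciprocity of [F]. *)
Lemma nonneg_circle_revJ d F : (size F <= d.*2.+1)%N ->
  (forall z, `|z| = 1 -> 0 <= F.[z] * z^* ^+ d) -> revJ d.*2 F = F.
Proof.
move=> sF F_ge0; apply: poly_unit_circle_inj => z z1.
rewrite horner_revJ_unit //.
have /CrealP := ger0_real (F_ge0 z z1).
rewrite rmorphM rmorphXn /= conjCK => Fr.
rewrite -addnn exprD -mulrA [z ^+ d * _^*]mulrC Fr mulrCA.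
by rewrite unitC_mulXJ // mulr1.
Qed.

(* Roots are removed in pairs [a], [1 / a^*] symmetric about the circle; a root
   on the circle is its own mirror image, and is double by nonnegativity. *)
Lemma fejer_riesz d F : (size F <= d.*2.+1)%N ->
  (forall z, `|z| = 1 -> 0 <= F.[z] * z^* ^+ d) ->
  exists2 Q : {poly K}, (size Q <= d.+1)%N &
    forall z, `|z| = 1 -> F.[z] * z^* ^+ d = `|Q.[z]| ^+ 2.
Proof.
elim: d F => [|d IHd] F sF F_ge0.
  have [c FE] : exists c, F = c%:P by exists F`_0; exact: size1_polyC.
  have c0 : 0 <= c.
    by have := F_ge0 1 (normr1 _); rewrite FE hornerC mulr1.
  exists (sqrtC c)%:P => [|z z1]; first exact: size_polyC_leq1.
  by rewrite FE !hornerC mulr1 -normrX sqrtCK ger0_norm.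
have Frev := nonneg_circle_revJ sF F_ge0.
have F0E : F`_0 = (F`_(d.+1).*2)^*.
  by rewrite -{1}Frev coef_poly subn0.
(* If the constant coefficient vanishes, so does the one of degree [2 d + 2]. Dividing by ['X] then
   lowers the degree bound by two, and the phase absorbs one factor [z]. *)
have [F0|F0] := eqVneq F`_0 0.
  have FN : F`_(d.+1).*2 = 0.
    by apply/eqP; rewrite -conjC_eq0 -F0E F0.
  have [G FE sG] := coef0_divX (size_leq_coef0 sF FN) F0.
  have FGE z : `|z| = 1 -> F.[z] * z^* ^+ d.+1 = G.[z] * z^* ^+ d.
    move=> z1; rewrite FE hornerMX exprS mulrA -[_ * z * _]mulrA.
    by rewrite unitC_mulJ // mulr1.
  have [||Q sQ QE] := IHd G => //.
    by move=> z z1; rewrite -FGE // F_ge0.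
  by exists Q => [|z z1]; [exact: leqW | rewrite FGE ?QE].
have /closed_rootP[a /[dup] Fa /factor_theorem[H FE]] : size F != 1%N.
  apply: contraNneq F0 => sF1.
  by rewrite F0E nth_default ?conjC0 // sF1.
have a0 : a != 0.
  by apply: contraNneq F0 => a0; rewrite -horner_coef0 -[X in F.[X]]a0.
have aJ0 : a^* != 0 by rewrite conjC_eq0.
pose b := (a^*)^-1.
have b0 : b != 0 by rewrite invr_eq0.
have /factor_theorem[G HE] : root H b.
  apply/rootP; have [ab|ab] := eqVneq b a.
    have a1 : `|a| = 1.
      apply/eqP; rewrite -(@eqrXn2 _ 2) ?normr_ge0 // expr1n normCK.
      by rewrite -{1}ab mulVf.
    rewrite ab; apply: (@nonneg_circle_double_root d.+1) => // z z1.
    by have := F_ge0 z z1; rewrite FE hornerM hornerXsubC [_ * (z - a)]mulrC.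
  have /eqP : F.[b] = 0.
    have := rootP Fa; rewrite -{1}Frev horner_revJ // => /eqP.
    by rewrite mulf_eq0 expf_eq0 (negbTE a0) andbF conjC_eq0 => /eqP.
  by rewrite FE hornerM hornerXsubC mulf_eq0 subr_eq0 (negbTE ab) orbF => /eqP.
(* On the circle [z - b] is [- b z] times the conjugate of [z - a], so the pair of roots contributes
   [- b z |z - a| ^ 2]; the constant [- b] goes into the quotient. *)
pose G' := - b *: G.
have FGE z : `|z| = 1 ->
    F.[z] * z^* ^+ d.+1 = G'.[z] * z^* ^+ d * `|z - a| ^+ 2.
  move=> z1; rewrite FE HE !hornerM !hornerXsubC hornerZ normCK rmorphB /= exprS.
  have -> : z - b = - b * z * (z^* - a^*).
    by rewrite mulrBr -mulrA unitC_mulJ // /b; field.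
  rewrite -[RHS]mulr1 -(unitC_mulJ z1); ring.
have sG : (size G' <= d.*2.+1)%N.
  have G0 : G != 0.
    by apply: contraNneq F0 => G0; rewrite FE HE G0 !mul0r coef0.
  apply: leq_trans (size_scale_leq _ _) _.
  move: sF; rewrite FE HE !size_Mmonic ?monicXsubC ?mulf_neq0 ?polyXsubC_eq0 //.
  by rewrite !size_XsubC !addn2 /= doubleS.
have G_ge0 z : `|z| = 1 -> z != a -> 0 <= G'.[z] * z^* ^+ d.
  move=> z1 za; have := F_ge0 z z1; rewrite FGE // pmulr_lge0 //.
  by rewrite exprn_gt0 // normr_gt0 subr_eq0.
have [||Q sQ QE] := IHd G' => //.
  (* Dividing by [|z - a| ^ 2] says nothing at [a] itself; there the sign comes from the limit. *)
  move=> z z1; have [za|za] := eqVneq z a; last exact: G_ge0.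
  by apply: nonneg_circle_closed => //; rewrite za in G_ge0 *.
exists (Q * ('X - a%:P)) => [|z z1].
  apply: leq_trans (size_polyMleq _ _) _.
  by rewrite size_XsubC addn2.
by rewrite FGE // QE // hornerM hornerXsubC normrM exprMn.
Qed.

(** * Complementary polynomials and lowering of the degree *)

Lemma mul_revJ_unit d p z : (size p <= d.+1)%N -> `|z| = 1 ->
  (p * revJ d p).[z] = z ^+ d * `|p.[z]| ^+ 2.
Proof.
by move=> sp z1; rewrite hornerM horner_revJ_unit // normCK mulrCA.
Qed.

(** On the circle, [z ^ d] times [1 - |P| ^ 2] is a polynomial of degree at most [2 d], to which
    [fejer_riesz] applies. *)
Lemma complementary_poly d P : (size P <= d.+1)%N ->
  (forall z, `|z| = 1 -> `|P.[z]| ^+ 2 <= 1) ->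
  exists2 Q : {poly K}, (size Q <= d.+1)%N &
    forall z, `|z| = 1 -> `|P.[z]| ^+ 2 + `|Q.[z]| ^+ 2 = 1.
Proof.
move=> sP P1; pose F := 'X^d - P * revJ d P.
have FE z : `|z| = 1 -> F.[z] * z^* ^+ d = 1 - `|P.[z]| ^+ 2.
  move=> z1; rewrite /F hornerD hornerN hornerXn mul_revJ_unit //.
  by rewrite -[X in X - _ * _]mulr1 -mulrBr mulrAC unitC_mulXJ // mul1r.
have [||Q sQ QE] := @fejer_riesz d F.
- apply: leq_trans (size_polyD _ _) _; rewrite size_polyN geq_max size_polyXn.
  apply/andP; split; first by rewrite -addnn ltnS leq_addl.
  apply: leq_trans (size_polyMleq _ _) _.
  have sr : (size (revJ d P) <= d.+1)%N := size_poly _ _.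
  rewrite -subn1 leq_subLR (leq_trans (leq_add sP sr)) //.
  by rewrite addSn addnS addnn add1n.
- by move=> z z1; rewrite FE // subr_ge0 P1.
by exists Q => // z z1; rewrite -QE // FE // addrC subrK.
Qed.

(** The normalisation reads [P * revJ d P + Q * revJ d Q = 'X^d]; for [d > 0] the right side has no
    constant coefficient. *)
Lemma complementary_coef_ortho d P Q : (0 < d)%N ->
    (size P <= d.+1)%N -> (size Q <= d.+1)%N ->
    (forall z, `|z| = 1 -> `|P.[z]| ^+ 2 + `|Q.[z]| ^+ 2 = 1) ->
  P`_0 * (P`_d)^* + Q`_0 * (Q`_d)^* = 0.
Proof.
move=> d0 sP sQ PQ1.
have E : P * revJ d P + Q * revJ d Q = 'X^d.
  apply: poly_unit_circle_inj => z z1.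
  by rewrite hornerD !mul_revJ_unit // -mulrDr PQ1 // mulr1 hornerXn.
move/(congr1 (fun p => p`_0)): E.
by rewrite coefD !coef0M !coef_poly subn0 coefXn eq_sym gtn_eqF.
Qed.

Lemma normalize2 (x y : K) : (x != 0) || (y != 0) ->
  exists2 r : K, r \is Num.real & `|r * x| ^+ 2 + `|r * y| ^+ 2 = 1.
Proof.
move=> xy; pose s := `|x| ^+ 2 + `|y| ^+ 2.
have s0 : 0 < s.
  rewrite lt0r addr_ge0 ?exprn_ge0 // andbT paddr_eq0 ?exprn_ge0 //.
  by rewrite !sqrf_eq0 !normr_eq0 negb_and.
have r0 : 0 < (sqrtC s)^-1 by rewrite invr_gt0 sqrtC_gt0.
exists (sqrtC s)^-1; first by rewrite gtr0_real.
by rewrite !normrM !exprMn -mulrDr -/s (gtr0_norm r0) exprVn sqrtCK mulVf ?lt0r_neq0.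
Qed.

(** Take the unit vector along [(x, y)]; if that is zero, one orthogonal to [(u, v)]; if both are
    zero, any. *)
Lemma orthogonal_unit_vector (x y u v : K) : x * u^* + y * v^* = 0 ->
  exists al be : K, [/\ `|al| ^+ 2 + `|be| ^+ 2 = 1,
    al * y = be * x & al^* * u + be^* * v = 0].
Proof.
move=> xyuv; have [xy|] := boolP ((x != 0) || (y != 0)).
  have [r rR rE] := normalize2 xy.
  exists (r * x), (r * y); split => //; first by ring.
  rewrite !rmorphM /= (conj_Creal rR) -!mulrA -mulrDr.
  move/(congr1 (fun z => z^*)): xyuv.
  by rewrite rmorphD !rmorphM /= !conjCK conjC0 => ->; rewrite mulr0.
rewrite negb_or !negbK => /andP[/eqP-> /eqP->].
have [uv|] := boolP ((v^* != 0) || (u^* != 0)).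
  have [r rR rE] := normalize2 uv.
  exists (r * v^*), (- (r * u^*)); split; rewrite ?normrN ?mulr0 //.
  by rewrite rmorphN !rmorphM /= !conjCK (conj_Creal rR); ring.
rewrite negb_or !negbK !conjC_eq0 => /andP[/eqP-> /eqP->].
by exists 1, 0; rewrite normr1 normr0 expr1n expr0n addr0 !mulr0 addr0.
Qed.

Lemma complementary_peel d P Q :
    (size P <= d.+2)%N -> (size Q <= d.+2)%N ->
    (forall z, `|z| = 1 -> `|P.[z]| ^+ 2 + `|Q.[z]| ^+ 2 = 1) ->
  exists al be P' Q', [/\ `|al| ^+ 2 + `|be| ^+ 2 = 1,
    (size P' <= d.+1)%N /\ (size Q' <= d.+1)%N,
    forall z, `|z| = 1 -> `|P'.[z]| ^+ 2 + `|Q'.[z]| ^+ 2 = 1,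
    P = - be^* *: (P' * 'X) + al *: Q' &
    Q = al^* *: (P' * 'X) + be *: Q'].
Proof.
move=> sP sQ PQ1.
have [al [be [ab1 h0 hd]]] :=
  orthogonal_unit_vector (complementary_coef_ortho (ltn0Sn d) sP sQ PQ1).
(* The inverse rotation: it kills the constant coefficient of [P1], making it divisible by ['X], and
   the leading coefficient of [Q1]. *)
pose P1 := - be *: P + al *: Q; pose Q1 := al^* *: P + be^* *: Q.
have size_comb x y : (size (x *: P + y *: Q)%R <= d.+2)%N.
  apply: leq_trans (size_polyD _ _) _.
  by rewrite geq_max !(leq_trans (size_scale_leq _ _)).
have [|P' P1E sP'] := coef0_divX (size_comb (- be) al).
  by rewrite coefD !coefZ h0 mulNr addNr.
have sQ1 : (size Q1 <= d.+1)%N.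
  by apply: size_leq_coef0 (size_comb _ _) _; rewrite coefD !coefZ.
have abE : al * al^* + be * be^* = 1 by rewrite -!normCK.
exists al, be, P', Q1; split=> //.
- move=> z z1; rewrite -[RHS](PQ1 z z1).
  have -> : `|P'.[z]| = `|P1.[z]| by rewrite /P1 P1E hornerMX normrM z1 mulr1.
  rewrite /P1 /Q1 !hornerD !hornerZ !normCK !rmorphD !rmorphM /= rmorphN /= !conjCK.
  by rewrite -[RHS]mul1r -abE; ring.
- rewrite -P1E /Q1 -[LHS]scale1r -abE -!mul_polyC !polyCD !polyCM !polyCN; ring.
- rewrite -P1E /Q1 -[LHS]scale1r -abE -!mul_polyC !polyCD !polyCM !polyCN; ring.
Qed.

End UnitCircle.

(** * Circuits *)

Lemma modn_expS n x : (x %% 2 ^ n.+1 = bit n x * 2 ^ n + x %% 2 ^ n)%N.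
Proof.
rewrite /bit {1}(divn_eq x (2 ^ n)) -{1}(odd_double_half (x %/ 2 ^ n)).
rewrite addnC mulnDl -muln2 -mulnA -expnS addnA addnC modnMDl addnC.
rewrite modn_small // expnS mul2n -addnn.
have := ltn_pmod x (expn_gt0 2 n : 0 < 2 ^ n)%N.
by case: odd; rewrite ?mul1n ?mul0n ?add0n ?ltn_add2l // => h; rewrite ltn_addr.
Qed.

Lemma eq_mod_bits n x y : (forall k, (k < n)%N -> bit k x = bit k y) ->
  x = y %[mod 2 ^ n].
Proof.
elim: n => [|n IHn] xy; first by rewrite !modn1.
by rewrite !modn_expS xy // IHn // => k kn; rewrite xy // ltnW.
Qed.

Lemma bit_mod n k x : (k < n)%N -> bit k (x %% 2 ^ n) = bit k x.
Proof.
move=> kn; have e : (2 ^ n = 2 ^ (n - k) * 2 ^ k)%N by rewrite -expnD subnK // ltnW.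
rewrite /bit {2}(divn_eq x (2 ^ n)) [X in (_ * X + _)%N]e mulnA divnMDl ?expn_gt0 //.
by rewrite oddD oddM oddX subn_eq0 leqNgt kn /= andbF.
Qed.

(** The ancilla is the top bit, so the locality condition of a gate on it becomes a congruence. *)
Lemma bits_eq_mod n (x y : nat) :
  [forall k : 'I_n.+1, (k != ord_max) ==> (bit k x == bit k y)] =
  (x == y %[mod 2 ^ n]).
Proof.
apply/forallP/eqP => [xy|xy k].
  apply: eq_mod_bits => k kn.
  have /implyP/(_ _)/eqP := xy (Ordinal (ltnW kn : k < n.+1)%N).
  by apply; rewrite -val_eqE /= ltn_eqF.
apply/implyP; rewrite -val_eqE /= => kn.
have {}kn : (k < n)%N by rewrite ltn_neqAle kn -ltnS ltn_ord.
by rewrite -(bit_mod _ kn) xy bit_mod.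
Qed.

Lemma ord_bit_mod n (x : 'I_(2 ^ n.+1)) : (x = bit n x * 2 ^ n + x %% 2 ^ n :> nat)%N.
Proof. by rewrite -modn_expS modn_small. Qed.

Lemma bit_small n x : (x < 2 ^ n)%N -> bit n x = false.
Proof. by move=> xn; rewrite /bit divn_small. Qed.

Lemma bit_addX n x : (x < 2 ^ n)%N -> bit n (2 ^ n + x) = true.
Proof. by move=> xn; rewrite /bit divnDl // divnn expn_gt0 divn_small. Qed.

(** Only [j] and [2 ^ n + j] contribute: a matrix product with an ancilla gate has two terms. *)
Lemma sum_ancilla n j (h : bool -> C) : (j < 2 ^ n)%N ->
  \sum_(y < 2 ^ n.+1) (if (y %% 2 ^ n == j)%N then h (bit n y) else 0) =
  h false + h true.
Proof.
move=> jn.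
have e2 : (2 ^ n.+1 = 2 ^ n + 2 ^ n)%N by rewrite expnS mul2n addnn.
have j0 : (j < 2 ^ n.+1)%N by rewrite e2 ltn_addr.
have j1 : (2 ^ n + j < 2 ^ n.+1)%N by rewrite e2 ltn_add2l.
rewrite (bigD1 (Ordinal j0)) //= (bigD1 (Ordinal j1)) /=; last first.
  by rewrite -val_eqE /= eq_sym -{1}[j]add0n eqn_add2r ltn_eqF ?expn_gt0.
rewrite modn_small // eqxx modnDl modn_small // eqxx bit_small // bit_addX //.
rewrite big1 ?addr0 // => y /andP[y0 y1]; case: eqP => // yj.
move: y0 y1; rewrite -!val_eqE /= (ord_bit_mod y) yj.
by case: bit; rewrite ?mul1n ?mul0n ?add0n eqxx.
Qed.

(** * The two kinds of gates used *)

(** The matrix taking [(P' * 'X, Q')] to [(P, Q)] in [complementary_peel]. *)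
Definition rot (al be : C) : 'M[C]_2 :=
  \matrix_(i, j) if i == 0 then if j == 0 then - be^* else al
                 else if j == 0 then al^* else be.

Lemma rot_unitary al be : `|al| ^+ 2 + `|be| ^+ 2 = 1 -> unitary (rot al be).
Proof.
rewrite !normCK => ab1; apply/matrixP => i j; rewrite !mxE !big_ord_recl big_ord0.
rewrite !mxE /= addr0.
case: i => [[|[|//]] ?]; case: j => [[|[|//]] ?] /=;
  rewrite ?rmorphN /= ?conjCK -?ab1 ?mulr1n ?mulr0n; ring.
Qed.

(** With the ancilla as first qubit, index 1 means ancilla 0 and second qubit 1. *)
Definition cphase (w : C) : 'M[C]_4 := diag_mx (\row_j if j == 1 then w else 1).

Lemma cphase_unitary w : `|w| = 1 -> unitary (cphase w).
Proof.
move=> w1; apply/matrixP => i j; rewrite !mxE (bigD1 i) //= big1 => [|k ki].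
  rewrite !mxE eqxx addr0 mulr1n; have [<-|_] := eqVneq i j; last first.
    by rewrite mulr0n conjC0 mulr0.
  by rewrite !mulr1n; case: ifP => _; rewrite unitC_mulJ ?normr1.
by rewrite !mxE [i == k]eq_sym (negbTE ki) mulr0n mul0r.
Qed.

(** * Circuits acting on the ancilla, and their size *)

Section Circuits.

Variable n : nat.
Implicit Types (W : 'M[C]_(2 ^ n.+1)) (f g : nat -> C).

(* On input [|0>|j>], with qubit [n] as ancilla, [W] produces
   [(f j |0> + g j |1>) |j>]. *)
Definition acts_as W f g : Prop :=
  forall x j : 'I_(2 ^ n.+1), (j < 2 ^ n)%N ->
    W x j = if (x %% 2 ^ n == j)%N then if bit n x then g j else f j else 0.

Lemma acts_as1 : acts_as 1%:M (fun=> 1) (fun=> 0).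
Proof.
move=> x j jn; rewrite !mxE -val_eqE /= {1}(ord_bit_mod x).
case: (bit n x); last by rewrite mul0n add0n; case: eqP.
rewrite mul1n gtn_eqF ?mulr0n; first by case: ifP.
by rewrite (leq_trans jn) // leq_addr.
Qed.

Lemma acts_as_rot W f g al be : acts_as W f g ->
  acts_as (gate_mx (Gate1 (@ord_max n) (rot al be)) *m W)
    (fun j => - be^* * f j + al * g j) (fun j => al^* * f j + be * g j).
Proof.
move=> Wfg x j jn; rewrite mxE.
pose h (b : bool) := rot al be (inord (bit n x)) (inord b) * (if b then g j else f j).
have -> : (if (x %% 2 ^ n == j)%N then
    if bit n x then al^* * f j + be * g j else - be^* * f j + al * g j else 0) =
    if (x %% 2 ^ n == j)%N then h false + h true else 0.
  rewrite /h !mxE -!val_eqE /= !inordK //; last by case: bit.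
  by case: (bit n x).
have [xj|xj] := eqVneq (x %% 2 ^ n)%N (j : nat).
  rewrite -(sum_ancilla h jn); apply: eq_bigr => y _.
  rewrite mxE bits_eq_mod Wfg // xj eq_sym.
  by case: eqP => _; rewrite ?mul0r.
rewrite big1 // => y _; rewrite mxE bits_eq_mod Wfg //.
case: eqP => [xy|]; last by rewrite mul0r.
by rewrite -xy (negbTE xj) mulr0.
Qed.

Lemma cphase_gateE (k : 'I_n.+1) w (x y : 'I_(2 ^ n.+1)) :
  (k < n)%N ->
  gate_mx (Gate2 (@ord_max n) k (cphase w)) x y =
  (if ~~ bit n x && bit k x then w else 1) *+ (x == y).
Proof.
move=> kn; rewrite !mxE.
have [<-|xy] := eqVneq x y.
  rewrite eqxx mulr1n.
  have -> : [forall k0 : 'I_n.+1, (k0 != ord_max) && (k0 != k) ==>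
     (bit k0 x == bit k0 x)] by apply/forallP => ?; rewrite eqxx implybT.
  rewrite mulr1n -val_eqE /= inordK; last by case: bit; case: bit.
  by case: (bit n x); case: (bit k x).
(* Since [cphase] is diagonal, a nonzero entry forces agreement on the two chosen qubits as well as
   on the others, hence [x = y]. *)
case: ifP => // /forallP bxy; rewrite mulr0n.
case: (inord _ =P inord _) => [/(congr1 val)|]; last by rewrite mulr0n.
rewrite /= !inordK; [|by case: bit; case: bit..] => e.
case/eqP: xy; apply/val_inj => /=.
rewrite -[LHS](modn_small (ltn_ord x)) -[RHS](modn_small (ltn_ord y)).
apply: eq_mod_bits => m mn.
have [->|mN] := eqVneq m n.
  by move: e; do 4 case: bit.
have [->|mk] := eqVneq m k; first by move: e; do 4 case: bit.
by have /implyP/(_ _)/eqP := bxy (Ordinal mn); apply; rewrite -!val_eqE /= mN.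
Qed.

Lemma acts_as_cphase W f g (k : 'I_n.+1) w : (k < n)%N -> acts_as W f g ->
  acts_as (gate_mx (Gate2 (@ord_max n) k (cphase w)) *m W)
    (fun j => (if bit k j then w else 1) * f j) g.
Proof.
move=> kn Wfg x j jn; rewrite mxE (bigD1 x) //= big1 => [|y yx]; last first.
  by rewrite cphase_gateE // eq_sym (negbTE yx) mulr0n mul0r.
rewrite addr0 cphase_gateE // eqxx mulr1n Wfg //.
case: eqP => [xj|]; last by rewrite mulr0.
by rewrite -xj bit_mod // xj; case: (bit n x); rewrite ?mul1r.
Qed.

Definition implementable m f g : Prop :=
  exists s : seq (gate n.+1),
    [/\ (size s <= m)%N, List.Forall (@gate_ok n.+1) s & acts_as (circuit_mx s) f g].

Lemma implementable_rcons m f g f' g' (u : gate n.+1) :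
  gate_ok u ->
  (forall W, acts_as W f g -> acts_as (gate_mx u *m W) f' g') ->
  implementable m f g -> implementable m.+1 f' g'.
Proof.
move=> uok uP [s [sm sok sfg]]; exists (rcons s u); split.
- by rewrite size_rcons.
- by rewrite -cats1; apply/List.Forall_app; split=> //; constructor.
- by rewrite /circuit_mx foldl_rcons; apply: uP.
Qed.

Lemma eq_implementable m f g f' g' :
  (forall j, (j < 2 ^ n)%N -> f j = f' j) ->
  (forall j, (j < 2 ^ n)%N -> g j = g' j) ->
  implementable m f g -> implementable m f' g'.
Proof.
move=> ff' gg' [s [sm sok sfg]]; exists s; split=> // x j jn.
by rewrite sfg // ff' // gg'.
Qed.

Lemma implementable_rot m f g al be : `|al| ^+ 2 + `|be| ^+ 2 = 1 ->
  implementable m f g ->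
  implementable m.+1 (fun j => - be^* * f j + al * g j)
    (fun j => al^* * f j + be * g j).
Proof.
move=> ab1; apply: (@implementable_rcons _ _ _ _ _ (Gate1 ord_max (rot al be))).
  exact: rot_unitary.
by move=> W; apply: acts_as_rot.
Qed.

Lemma implementable_mul_power m f g w : `|w| = 1 -> implementable m f g ->
  implementable (m + n) (fun j => w ^+ j * f j) g.
Proof.
move=> w1 mfg.
(* After [l] gates the exponent consists of the lowest [l] bits of [j]; bit [l] contributes the
   phase [w ^ (2 ^ l)]. *)
suff h l : (l <= n)%N -> implementable (m + l) (fun j => w ^+ (j %% 2 ^ l) * f j) g.
  by apply: eq_implementable (h n _) => // j jn; rewrite modn_small.
elim: l => [|l IHl] ln.
  by rewrite addn0; apply: eq_implementable mfg => // j _; rewrite modn1 mul1r.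
have ln' : (l < n.+1)%N by rewrite ltnW.
pose u := Gate2 ord_max (Ordinal ln') (cphase (w ^+ (2 ^ l))).
rewrite addnS; apply: (@implementable_rcons _ _ _ _ _ u) (IHl (ltnW ln)).
  split; last by apply: cphase_unitary; rewrite normrX w1 expr1n.
  by move/(congr1 val) => /= e; rewrite e ltnn in ln.
move=> W WP x j jn; rewrite (acts_as_cphase (w ^+ (2 ^ l)) _ WP) //=.
do 2 case: ifP => //= _; rewrite modn_expS mulrA; congr (_ * _).
by case: bit; rewrite ?mul1n ?mul0n ?exprD ?mul1r.
Qed.

(** The constant case costs one rotation, and each further degree costs [n] controlled phases and
    one rotation. *)
Lemma implementable_poly w d (P Q : {poly C}) : `|w| = 1 ->
    (size P <= d.+1)%N -> (size Q <= d.+1)%N ->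
    (forall z : C, `|z| = 1 -> `|P.[z]| ^+ 2 + `|Q.[z]| ^+ 2 = 1) ->
  implementable (d * n.+1).+1 (fun j => P.[w ^+ j]) (fun j => Q.[w ^+ j]).
Proof.
move=> w1; elim: d P Q => [|d IHd] P Q sP sQ PQ1.
  have [p PE] : exists p, P = p%:P by exists P`_0; exact: size1_polyC.
  have [q QE] : exists q, Q = q%:P by exists Q`_0; exact: size1_polyC.
  (* With [al = conj q] and [be = - conj p], the first column of [rot] is [(p, q)], the image of
     [(1, 0)]. *)
  have pq1 : `|q^*| ^+ 2 + `|- p^*| ^+ 2 = 1.
    rewrite normrN !norm_conjC addrC.
    by have := PQ1 1 (normr1 _); rewrite PE QE !hornerC.
  have i1 : implementable 0 (fun=> 1) (fun=> 0).
    by exists [::]; split=> //; apply: acts_as1.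
  apply: eq_implementable (implementable_rot pq1 i1) => j _.
    by rewrite PE hornerC rmorphN /= conjCK opprK mulr1 mulr0 addr0.
  by rewrite QE hornerC conjCK mulr1 mulr0 addr0.
have [al [be [P' [Q' [ab1 [sP' sQ'] PQ1' PE QE]]]]] := complementary_peel sP sQ PQ1.
have := implementable_rot ab1 (implementable_mul_power w1 (IHd _ _ sP' sQ' PQ1')).
have -> : ((d.+1 * n.+1).+1 = ((d * n.+1).+1 + n).+1)%N by lia.
apply: eq_implementable => j _.
  by rewrite PE hornerD !hornerZ hornerMX [_ * w ^+ j]mulrC.
by rewrite QE hornerD !hornerZ hornerMX [_ * w ^+ j]mulrC.
Qed.

End Circuits.

(** * Evaluation at the roots of unity and the gate count *)

Lemma norm_omega N : `|omega N| = 1.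
Proof.
rewrite normc_def /=.
suff -> : forall t, Rtrigo_def.cos t ^+ 2 + Rtrigo_def.sin t ^+ 2 = 1 by rewrite sqrtr1.
by move=> t; rewrite addrC !expr2; exact: Rtrigo1.sin2_cos2.
Qed.

Lemma PofUE n P (i j : 'I_(2 ^ n.+1)) : (i < 2 ^ n)%N -> (j < 2 ^ n)%N ->
  PofU n P (inord i) (inord j) = P.[omega (2 ^ n) ^+ j] *+ (i == j).
Proof.
move=> i_n j_n; have UE : Uomega n = diag_mx (\row_i omega (2 ^ n) ^+ i).
  by apply/matrixP => k l; rewrite !mxE; case: eqP => [->|].
have N0 : (0 < 2 ^ n)%N by rewrite expn_gt0.
rewrite /PofU UE horner_mx_diag !mxE -!val_eqE /= !inordK ?prednK //.
by case: eqP => [->|].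
Qed.

Theorem theorem10 :
  exists K : nat,
  forall (n d : nat) (P : {poly C}) (c : Rdefinitions.R),
    (1 <= n)%N -> (1 <= d)%N ->
    size P = d.+1 ->
    (forall x : C, `|x| = 1 -> `|P.[x]| ^+ 2 <= (c%:C)%C) ->
    exists s : seq (gate n.+1),
      (size s <= K * d * n)%N /\
      List.Forall (@gate_ok n.+1) s /\
      (forall i j : 'I_(2 ^ n.+1), (i < 2 ^ n)%N -> (j < 2 ^ n)%N ->
         circuit_mx s i j = PofU n P (inord i) (inord j) / ((Num.sqrt c)%:C)%C).
Proof.
(* The circuit has at most [d (n + 1) + 1] gates, and both [d] and [1] are at most [d n]. *)
exists 3%N => n d P c n1 d1 sP Pc.
set r := ((Num.sqrt c)%:C)%C.
have c0 : 0 <= (c%:C)%C.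
  by apply: le_trans (Pc 1 (normr1 _)); rewrite exprn_ge0.
have rE : r ^+ 2 = (c%:C)%C.
  by rewrite -rmorphXn sqr_sqrtr // -lecR.
have r_ge0 : 0 <= r by rewrite lecR sqrtr_ge0.
(* If [c] were 0, [P] would vanish on the whole circle, against its degree. *)
have r0 : r != 0.
  apply/eqP => r0; suff P0 : P = 0 by move: sP; rewrite P0 size_poly0.
  apply: poly_unit_circle_eq0 => z z1; apply/eqP.
  rewrite -normr_eq0 -sqrf_eq0 eq_le exprn_ge0 // andbT.
  by have := Pc z z1; rewrite -rE r0 expr0n.
pose P1 := r^-1 *: P.
have sP1 : (size P1 <= d.+1)%N by rewrite size_scale ?invr_eq0 // sP.
have P1_le1 z : `|z| = 1 -> `|P1.[z]| ^+ 2 <= 1.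
  move=> z1; rewrite hornerZ normrM exprMn normfV (ger0_norm r_ge0) exprVn rE.
  by rewrite ler_pdivrMl ?mulr1 ?Pc // -rE exprn_gt0 // lt0r r0.
have [Q sQ PQ1] := complementary_poly sP1 P1_le1.
have [s [sm sok sPQ]] := implementable_poly n (norm_omega (2 ^ n)) sP1 sQ PQ1.
exists s; split; [|split] => //.
  by apply: leq_trans sm _; nia.
(* A row index below [2 ^ n] has ancilla bit 0, which selects the component carrying [P1]. *)
move=> i j i_n j_n; rewrite sPQ // PofUE // modn_small // bit_small //.
by rewrite -val_eqE /= /P1 hornerZ mulrC; case: eqP; rewrite ?mul0r.
Qed.
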